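(* Let $\mathcal B\subseteq\mathbb N$ be an infinite primitive set, with associated $H$, $W$, $\eta$, $X_\eta$, $M$, $\mathcal A_S$. The following are equivalent: (C1) $\operatorname{int}(W)=\emptyset$. (C2) $\bigcup_{S\subset\mathcal B\text{ finite}}\mathcal F_{\mathcal A_S}=\emptyset$, i.e. $\mathcal F_{\mathcal A_S}=\emptyset$ for all finite $S\subset\mathcal B$. (C3) For all finite $S\subset\mathcal B$: $1\in\mathcal A_S$. (C4) $\mathcal B$ contains an infinite pairwise coprime subset. (C5) If $\mathcal C\subseteq\mathbb N$ is finite and $\mathcal B\subseteq\mathcal M_{\mathcal C}$, then $1\in\mathcal C$. (C6) $M=\{(\dots,0,0,0,\dots)\}$. (C7) The dynamics on $X_\eta$ are proximal.
   Context: $\mathbb N=\{1,2,\dots\}$. For $A\subseteq\mathbb N$ let $\mathcal M_A=\bigcup_{a\in A}a\mathbb Z$ and $\mathcal F_A=\mathbb Z\setminus\mathcal M_A$. $\mathcal B$ is primitive if there are no distinct $b,b'\in\mathcal B$ with $b\mid b'$. $\Delta:\mathbb Z\to\prod_{b\in\mathcal B}\mathbb Z/b\mathbb Z$, $\Delta(n)=(n \bmod b)_{b\in\mathcal B}$; $H:=\overline{\Delta(\mathbb Z)}$ is a compact abelian group (product topology); the window is $W:=\{h\in H: h_b\neq 0\ \forall b\in\mathcal B\}$; $\operatorname{int}(W)$ is its interior in $H$. For finite $S\subset\mathcal B$: $\mathcal A_S:=\{\gcd(b,\operatorname{lcm}(S)):b\in\mathcal B\}$. $\eta\in\{0,1\}^{\mathbb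 Z}$ is the indicator function of $\mathcal F_{\mathcal B}$; $\sigma$ is the left shift; $X_\eta=\overline{\{\sigma^n\eta:n\in\mathbb Z\}}\subseteq\{0,1\}^{\mathbb Z}$. It is known that $(X_\eta,\sigma)$ has a unique minimal subset, denoted $M$. The dynamics on $X_\eta$ are proximal if $\liminf_{n\to\infty}\rho(\sigma^nx,\sigma^ny)=0$ for all $x,y\in X_\eta$, where $\rho$ is a metric inducing the product topology. *)

(* Defs.v *)
From HB Require Import structures.
From mathcomp Require Import all_boot all_order all_algebra.
From mathcomp Require Import finmap.
From mathcomp Require Import all_classical all_reals all_analysis.

Set Implicit Arguments.
Unset Strict Implicit.
Unset Printing Implicit Defensive.

Import Order.TTheory GRing.Theory Num.Theory.
Import numFieldNormedType.Exports.

Local Open Scope classical_set_scope.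
Local Open Scope ring_scope.

(* Subsets of {1, 2, ...} are sets A : set nat with A `<=` positive. *)
Definition positive : set nat := [set n | (0 < n)%N].

Definition multiples (A : set nat) : set int :=
  \bigcup_(a in A) [set m : int | (a%:Z %| m)%Z].

Definition free_numbers (A : set nat) : set int := ~` multiples A.

Definition primitive (B : set nat) : Prop :=
  forall b b' : nat, B b -> B b' -> b <> b' -> ~~ (b %| b')%N.

Definition lcm_fset (S : {fset nat}) : nat := \big[lcmn/1%N]_(s <- S) s.

Definition gcd_set (B : set nat) (S : {fset nat}) : set nat :=
  [set gcdn b (lcm_fset S) | b in B].

(* Z/bZ for b >= 1. The carrier is 'I_(b.-1.+1) and not 'Z_b, because 'Z_1 has
   two elements. *)
Notation residue b := (discrete_topology 'I_(b.-1.+1)).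

(* n mod b; the absolute value only casts the nonnegative remainder to nat. *)
Definition to_residue (b : nat) (n : int) : residue b :=
  (inZp `|(n %% b%:Z)%Z|%N : 'I_(b.-1.+1)).

Definition residue0 (b : nat) : residue b := (ord0 : 'I_(b.-1.+1)).

Notation residues B := (prod_topology (fun b : set_type B => residue (val b))).

Definition Delta (B : set nat) (n : int) : residues B :=
  fun b => to_residue (val b) n.
Arguments Delta : clear implicits.

Definition orbit_group (B : set nat) : set (residues B) :=
  closure (range (Delta B)).
Arguments orbit_group : clear implicits.

(* A subset of the subtype of points of orbit_group B, which carries the
   subspace topology, so that (window B)° is the interior relative to H. *)
Definition window (B : set nat) : set (orbit_group B) :=
  [set h | forall b : B, set_val h b != residue0 (val b)].
Arguments window : clear implicits.

Notation config := {ptws int -> bool}.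

(* left_shift n is the n-th power of the left shift, for n of either sign. *)
Definition left_shift (n : int) (x : config) : config := fun i => x (i + n).

Definition eta (B : set nat) : config := fun n => `[< free_numbers B n >].

Definition orbit_closure (x : config) : set config :=
  closure (range (fun n : int => left_shift n x)).

Definition X_eta (B : set nat) : set config := orbit_closure (eta B).

Definition subsystem (Y : set config) : Prop :=
  [/\ Y !=set0, closed Y & left_shift 1 @` Y = Y].

Definition minimal_subset (X Y : set config) : Prop :=
  [/\ Y `<=` X, subsystem Y &
      forall Z : set config, subsystem Z -> Z `<=` Y -> Z = Y].

(* Definite description; the fallback set0, taken when X has no minimal subset
   or several ones, is not a subsystem. *)
Definition the_minimal_subset (X : set config) : set config :=
  xget set0 [set Y | minimal_subset X Y /\
                     forall Z, minimal_subset X Z -> Z = Y].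

Definition zero_config : config := fun=> false.

Definition is_metric (R : realType) (T : Type) (rho : T -> T -> R) : Prop :=
  [/\ forall x y, rho x y = 0 <-> x = y,
      forall x y, rho x y = rho y x &
      forall x y z, rho x z <= rho x y + rho y z].

Definition induces_topology (R : realType) (T : topologicalType)
    (rho : T -> T -> R) : Prop :=
  forall x : T, nbhs x = nbhs_ball_ (fun y e => [set z | rho y z < e]) x.

Definition proximal_on (R : realType) (rho : config -> config -> R)
    (X : set config) : Prop :=
  forall x y, X x -> X y ->
    limn_einf (fun n : nat => (rho (left_shift n%:Z x) (left_shift n%:Z y))%:E)
    = 0%E.

(* Main.v *)
Require Import Defs.
From HB Require Import structures.
From mathcomp Require Import all_boot all_order all_algebra.
From mathcomp Require Import finmap.
From mathcomp Require Import all_classical all_reals all_analysis.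
From mathcomp Require Import zify ring lra.

(* C3 produces coprime elements one at a time: b with gcd(b, lcm S) = 1 is coprime
   to every element of S, and b <> 1 by primitivity, so b is new. Conversely a
   finite C whose multiples cover an infinite pairwise coprime set has an element
   dividing two coprime numbers, so C5 holds, and C5 applied to C = A_S gives C3.
   If 1 is not in A_S, the cylinder of H around Delta(1) with coordinates in S lies
   in the window; if b is coprime to lcm S, every cylinder with coordinates in S
   contains some Delta(m) with b | m, outside the window.
   Each x in X_eta vanishes, for each b in B, on some residue class mod b. With
   infinitely many coprime b, the Chinese remainder theorem makes any two points of
   X_eta vanish simultaneously on arbitrarily long blocks arbitrarily far to the
   right; this gives C6 and C7. If instead B is contained in M_C with C finite and
   1 not in C, then eta = 1 on 1 + lcm(C) Z. So 0 is not in X_eta, and as eta also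
   vanishes on bZ, eta is not constant on long intervals, so eta and its shift do
   not come close: by compactness, a rho-small pair agrees on a prescribed finite set
   of coordinates. *)

Set Implicit Arguments.
Unset Strict Implicit.
Unset Printing Implicit Defensive.

Import Order.TTheory GRing.Theory Num.Theory.
Import numFieldNormedType.Exports.

Local Open Scope classical_set_scope.
Local Open Scope ring_scope.

(** * Least common multiples of finite sets, and residues *)

Lemma dvdn_lcm_fset (S : {fset nat}) (b : nat) :
  b \in S -> (b %| lcm_fset S)%N.
Proof.
rewrite /lcm_fset -[b \in S]/(b \in enum_fset S).
elim: (enum_fset S) => // a s IH.
rewrite inE big_cons => /orP[/eqP <-|/IH bs]; first exact: dvdn_lcml.
exact: dvdn_trans bs (dvdn_lcmr _ _).
Qed.

Lemma lcm_fset_dvdz (S : {fset nat}) (n : int) :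
  (forall b, b \in S -> (b%:Z %| n)%Z) -> ((lcm_fset S)%:Z %| n)%Z.
Proof.
rewrite /lcm_fset => Sn.
have {Sn} : forall b, b \in enum_fset S -> (b%:Z %| n)%Z by [].
elim: (enum_fset S) => [|a s IH] Hs; first by rewrite big_nil.
rewrite big_cons dvdz_lcm Hs ?mem_head// IH// => b bs.
by rewrite Hs // inE bs orbT.
Qed.

Lemma lcm_fset_gt0 (S : {fset nat}) :
  [set` S] `<=` positive -> (0 < lcm_fset S)%N.
Proof.
rewrite /lcm_fset => Spos.
have {Spos} : forall b, b \in enum_fset S -> (0 < b)%N by move=> b bS; apply: Spos.
elim: (enum_fset S) => [|a s IH] Hs; first by rewrite big_nil.
rewrite big_cons lcmn_gt0 Hs ?mem_head// IH// => b bs.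
by rewrite Hs // inE bs orbT.
Qed.

Lemma finite_set_common_multiple (C : set nat) :
  C `<=` positive -> finite_set C ->
  exists2 L : nat, (0 < L)%N & forall c, C c -> (c %| L)%N.
Proof.
move=> Cpos Cfin; exists (lcm_fset (fset_set C)).
  by apply: lcm_fset_gt0 => c /=; rewrite in_fset_set// inE => /Cpos.
by move=> c Cc; apply: dvdn_lcm_fset; rewrite in_fset_set// inE.
Qed.

(** Positivity matters: for [b = 0] the carrier has one element, while divisibility by 0 means
    equality. *)
Lemma to_residue_eq (b : nat) (m n : int) : (0 < b)%N ->
  to_residue b m = to_residue b n <-> (b%:Z %| m - n)%Z.
Proof.
move=> b0; have bz : b%:Z != 0 by rewrite eqz_nat -lt0n.
have small p : (`|(p %% b%:Z)%Z|%N < b)%N.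
  by rewrite -ltz_nat gez0_abs ?modz_ge0 // ltz_pmod.
rewrite -eqz_mod_dvd; split=> [|/eqP e]; last by rewrite /to_residue e.
rewrite /to_residue => /(congr1 val) /=; rewrite prednK// !modn_small// => e.
rewrite -[X in X == _]gez0_abs ?modz_ge0 //.
by rewrite -[X in _ == X]gez0_abs ?modz_ge0 // e.
Qed.

Lemma to_residue0 (b : nat) : to_residue b 0 = residue0 b.
Proof. by rewrite /to_residue mod0z; apply/val_inj; rewrite /= mod0n. Qed.

Lemma to_residue_eq0 (b : nat) (m : int) : (0 < b)%N ->
  to_residue b m = residue0 b <-> (b%:Z %| m)%Z.
Proof. by move=> b0; rewrite -to_residue0 to_residue_eq// subr0. Qed.

(** * Chinese remainder theorem for pairwise coprime sequences *)

Lemma chinese_remainder_dvdz (m1 m2 : nat) (r1 r2 : int) : coprime m1 m2 ->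
  exists n : int, (m1%:Z %| n - r1)%Z /\ (m2%:Z %| n - r2)%Z.
Proof.
move=> co; exists (zchinese m1%:Z m2%:Z r1 r2).
by split; rewrite -eqz_mod_dvd; apply/eqP; rewrite (zchinese_modl, zchinese_modr).
Qed.

Lemma chinese_remainder_seq (f : nat -> nat) (r : nat -> int) (N : nat) :
  (forall i, 0 < f i)%N -> (forall i j, i <> j -> coprime (f i) (f j)) ->
  forall k : nat, exists2 n : nat, (N <= n)%N &
    forall i, (i < k)%N -> ((f i)%:Z %| n%:Z - r i)%Z.
Proof.
move=> f0 fco k; pose P k := (\prod_(i < k) f i)%N.
have dvdP l i : (i < l)%N -> (f i %| P l)%N.
  by move=> il; rewrite /P (bigD1 (Ordinal il)) //= dvdn_mulr.
have [n nr] : exists n : int, forall i, (i < k)%N -> ((f i)%:Z %| n - r i)%Z.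
  elim: k => [|k [n IH]]; first by exists 0.
  have co : coprime (P k) (f k).
    rewrite coprime_sym /P; elim/big_rec: _ => [|i m _ IHm]; first exact: coprimen1.
    rewrite coprimeMr IHm andbT; apply: fco.
    by move=> e; have := ltn_ord i; rewrite -e ltnn.
  have [m [mn mk]] := chinese_remainder_dvdz n (r k) co.
  exists m => i; rewrite ltnS leq_eqVlt => /orP[/eqP ->//|ik].
  rewrite -(subrK n m) -addrA rpredD ?IH//; apply: dvdz_trans mn.
  exact: dvdP.
have P0 : (0 < P k)%N by apply: prodn_gt0.
(* As [P k] is at least 1, adding [P k] times this [q] lifts [n] to at least [N] and keeps all its
   residues. *)
pose q := (absz n + N)%N.
have [p [pN pn]] : exists p : nat, (N <= p)%N /\ p%:Z = n + (P k)%:Z * q%:Z.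
  by exists (absz (n + (P k)%:Z * q%:Z)); move: (P k) P0 => p p0; rewrite /q; nia.
exists p => // i ik; rewrite pn addrAC rpredD ?nr//.
by apply: dvdz_mulr; exact: dvdP.
Qed.

(** * The arithmetic conditions C2 to C5 *)

Lemma multiples1 (A : set nat) : A 1%N -> multiples A = setT.
Proof.
by move=> A1; apply/seteqP; split=> // m _; exists 1%N => //=; rewrite dvd1z.
Qed.

Lemma free_numbers1 (A : set nat) : ~ A 1%N -> free_numbers A 1.
Proof.
move=> A1 [a Aa /=]; rewrite dvdz1 => /eqP a1.
by apply: A1; rewrite -(a1 : a = 1%N).
Qed.

(** The number 1 decides both sides: it is free unless it lies in the set, and once it lies there
    every integer is a multiple. *)
Lemma gcd_set_free_numbers_empty (B : set nat) :
  (\bigcup_(S in [set S : {fset nat} | [set` S] `<=` B])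
     free_numbers (gcd_set B S) = set0) <->
  (forall S : {fset nat}, [set` S] `<=` B -> gcd_set B S 1%N).
Proof.
split=> [E S SB|H].
  apply: contrapT => /free_numbers1 F1.
  by suff : set0 (1 : int) by []; rewrite -E; exists S.
rewrite -subset0 => n [S SB]; apply.
by rewrite multiples1//; apply: H.
Qed.

Lemma coprime_seq_of_gcd_set (B : set nat) : infinite_set B -> primitive B ->
  (forall S : {fset nat}, [set` S] `<=` B -> gcd_set B S 1%N) ->
  exists D : set nat, [/\ D `<=` B, infinite_set D &
    forall a b, D a -> D b -> a <> b -> coprime a b].
Proof.
move=> Binf Bprim H.
have B1 : ~ B 1%N.
  move=> B1; apply: Binf; apply: sub_finite_set (finite_set1 1%N) => b Bb.
  apply: contrapT => b1; have := Bprim _ _ B1 Bb; rewrite dvd1n => /(_ _)/negP.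
  by apply => // e; apply: b1; rewrite -e.
have /choice[g gP] : forall S : {fset nat}, exists b : nat,
    [set` S] `<=` B -> B b /\ coprime b (lcm_fset S).
  (* The choice function must be total; 0 is a dummy value for [S] not contained in [B]. *)
  move=> S; have [SB|nSB] := pselect ([set` S] `<=` B); last by exists 0%N.
  by have [b Bb /eqP cb] := H S SB; exists b.
(* [s n] collects the first [n] chosen elements, so [g (s n)] is coprime to all of them. *)
pose s := fix s n := if n is m.+1 then (g (s m) |` s m)%fset else fset0.
have sB n : [set` s n] `<=` B.
  elim: n => [|n IH] b //=; rewrite !inE => /orP[/eqP ->|]; last exact: IH.
  by case: (gP _ IH).
have gs m n : (m < n)%N -> g (s m) \in s n.
  elim: n => // n IH; rewrite ltnS leq_eqVlt => /orP[/eqP ->|/IH mn] /=.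
    by rewrite !inE eqxx.
  by rewrite !inE mn orbT.
have co m n : (m < n)%N -> coprime (g (s m)) (g (s n)).
  move=> mn; have [_ cn] := gP _ (sB n).
  by rewrite coprime_sym; apply: coprime_dvdr cn; apply/dvdn_lcm_fset/gs.
have gB n : B (g (s n)) by case: (gP _ (sB n)).
(* Equal terms with different indices would be coprime to themselves, hence equal to 1. *)
have inj : injective (g \o s).
  move=> m n /= e; case: (ltngtP m n) => // /co;
    by rewrite e /coprime gcdnn => /eqP e1; case: B1; rewrite -e1.
exists (range (g \o s)); split.
- by move=> _ [n _ <-]; exact: gB.
- apply/infiniteP; have /card_eqPle[] // : (range (g \o s) #= [set: nat])%card.
  by apply: inj_card_eq => m n _ _; exact: inj.
- move=> _ _ [m _ <-] [n _ <-] /= ne; case: (ltngtP m n) => [/co//|/co|e].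
    by rewrite coprime_sym.
  by rewrite e in ne.
Qed.

(** If 1 is not in [C], each [c] in [C] divides at most one element of [D], which makes [D] a finite
    union of finite sets. *)
Lemma coprime_subset_multiples (D C : set nat) :
  infinite_set D -> (forall a b, D a -> D b -> a <> b -> coprime a b) ->
  finite_set C -> [set b%:Z | b in D] `<=` multiples C -> C 1%N.
Proof.
move=> Dinf Dco Cfin DC; apply: contrapT => C1; apply: Dinf.
apply: (@sub_finite_set _ _ (\bigcup_(c in C) [set d | D d /\ (c %| d)%N])).
  by move=> d Dd; have [|c Cc cd] := DC d%:Z; [exists d|exists c].
apply: bigcup_finite => // c Cc.
have [[a [Da ca]]|none] := pselect (exists a, D a /\ (c %| a)%N); last first.
  by apply: (@sub_finite_set _ _ set0) => // a Ha; case: none; exists a.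
apply: sub_finite_set (finite_set1 a) => b [Db cb] /=.
apply: contrapT => /(Dco _ _ Db Da) /eqP g1; apply: C1.
have : (c %| gcdn b a)%N by rewrite dvdn_gcd cb ca.
by rewrite g1 dvdn1 => /eqP <-.
Qed.

(** The covering condition is applied to [gcd_set B S] itself: it is finite because its elements
    divide [lcm_fset S], and it covers [B] because each gcd divides its [b]. *)
Lemma gcd_set_of_multiples (B : set nat) (S : {fset nat}) :
  B `<=` positive -> [set` S] `<=` B ->
  (forall C : set nat, C `<=` positive -> finite_set C ->
     [set b%:Z | b in B] `<=` multiples C -> C 1%N) ->
  gcd_set B S 1%N.
Proof.
move=> Bpos SB; apply.
- by move=> _ [b Bb <-] /=; rewrite /positive /= gcdn_gt0 Bpos.
- have L0 : (0 < lcm_fset S)%N by apply: lcm_fset_gt0 => b /SB /Bpos.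
  apply: (@sub_finite_set _ _ `I_(lcm_fset S).+1); last exact: finite_II.
  by move=> _ [b Bb <-] /=; rewrite ltnS dvdn_leq// dvdn_gcdr.
- move=> _ [b Bb <-]; exists (gcdn b (lcm_fset S)); first by exists b.
  exact: dvdn_gcdl.
Qed.

Lemma infinite_set_injection (D : set nat) : infinite_set D ->
  exists2 f : nat -> nat, injective f & forall n, D (f n).
Proof.
move=> /infiniteP/pcard_leP[f]; exists f => [m n e|n].
  by apply: (@inj _ _ _ f); rewrite ?in_setT.
exact: (@funS _ _ _ _ f).
Qed.

(** * Cylinder neighbourhoods in products of discrete spaces *)

Lemma nbhs_prod_discreteP (I : choiceType) (T : I -> topologicalType)
    (x : prod_topology T) (A : set (prod_topology T)) :
  (forall i (t : T i), nbhs t [set t]) ->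
  nbhs x A <-> exists S : seq I,
    forall y : prod_topology T, (forall i, i \in S -> y i = x i) -> A y.
Proof.
move=> disc; pose cyl (S : seq I) : set (prod_topology T) :=
  [set y | forall i, i \in S -> y i = x i].
split=> [nA|[S SA]]; last first.
  apply: (@filterS _ _ _ (cyl S)) => [y|]; first exact: SA.
  elim: S {SA} => [|i S IH]; first by apply: filterS filterT => y _ i.
  have ni : nbhs x [set y : prod_topology T | y i = x i].
    exact: (@proj_continuous I T i x) (disc i (x i)).
  apply: filterS (filterI ni IH) => y [yi yS] j.
  by rewrite inE => /orP[/eqP ->|/yS].
(* The product topology is a supremum of coordinate topologies, so convergence to [x] of the filter
   generated by cylinders is checked one coordinate at a time. *)
pose F := filter_from [set: seq I] cyl.
have FF : Filter F.
  apply: filter_from_filter; first by exists [::].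
  move=> S S' _ _; exists (S ++ S') => // y yS.
  by split=> i iS; apply: yS; rewrite mem_cat iS ?orbT.
have /(_ A nA)[S _ SA] : F --> x; last by exists S => y; exact: SA.
apply/cvg_sup => i B [_ [[C oC <-] Cx] CB].
exists [:: i] => // y yi; apply: CB => /=.
by rewrite /proj yi ?mem_head.
Qed.

Lemma nbhs_configP (x : config) (A : set config) :
  nbhs x A <-> exists S : seq int,
    forall y : config, (forall i, i \in S -> y i = x i) -> A y.
Proof.
apply: nbhs_prod_discreteP => i t.
by rewrite nbhs_principalE; apply/principal_filterP.
Qed.

(** The coordinates are recorded as a finite subset of [B], so that [lcm_fset] applies to them. *)
Lemma nbhs_residuesP (B : set nat) (x : residues B) (A : set (residues B)) :
  nbhs x A <-> exists2 S : {fset nat}, [set` S] `<=` B &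
    forall y : residues B,
      (forall b : set_type B, val b \in S -> y b = x b) -> A y.
Proof.
have disc (b : set_type B) (t : residue (val b)) : nbhs t [set t].
  by rewrite nbhs_principalE; apply/principal_filterP.
rewrite (nbhs_prod_discreteP _ _ disc); split=> [[S SA]|[S SB SA]].
  exists [fset val b | b in S]%fset.
    by move=> _ /= /imfsetP[b _ ->]; exact: set_valP.
  by move=> y yS; apply: SA => b bS; apply: yS; apply/imfsetP; exists b.
exists (pmap insub S) => y yS; apply: SA => b bS; apply: yS.
by rewrite mem_pmap_sub.
Qed.

(** * The interior of the window *)

Lemma Delta_coordinatesP (B : set nat) (S : {fset nat}) (m n : int) :
  B `<=` positive -> [set` S] `<=` B ->
  (forall b : set_type B, val b \in S -> Delta B m b = Delta B n b) <->
  ((lcm_fset S)%:Z %| m - n)%Z.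
Proof.
move=> Bpos SB; split=> [e|d b bS].
  apply: lcm_fset_dvdz => b bS; apply/to_residue_eq; first exact/Bpos/SB.
  exact: (e (exist _ b (mem_set (SB b bS)))).
apply/to_residue_eq; first exact/Bpos/set_valP.
by apply: dvdz_trans d; exact: dvdn_lcm_fset.
Qed.

Lemma window_interior_empty (B : set nat) : B `<=` positive ->
  ((@window B)° = set0) <->
  (forall S : {fset nat}, [set` S] `<=` B -> gcd_set B S 1%N).
Proof.
move=> Bpos; split=> [W0 S SB|H].
  apply: contrapT => S1.
  have D1 : orbit_group B (Delta B 1) by apply: subset_closure; exists 1.
  pose h1 : orbit_group B := exist _ (Delta B 1) (mem_set D1).
  suff : (@window B)° h1 by rewrite W0.
  pose U : set (residues B) := [set h |
    forall b : set_type B, val b \in S -> h b = Delta B 1 b].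
  have nU : nbhs (set_val h1) U by apply/nbhs_residuesP; exists S.
  have nU1 : nbhs h1 (set_val @^-1` U) by exact: initial_continuous nU.
  (* If [h] had coordinate 0 at [b], some [Delta B n] agreeing with [h] on [S] and [b] would give
     [n] divisible by [b] and congruent to 1 modulo [lcm_fset S], so their gcd would be 1. *)
  apply: (filterS _ nU1) => h Uh b; apply/eqP => hb.
  have hH : orbit_group B (set_val h) by exact: set_valP.
  have [|_ [[n _ <-] nS]] := hH [set y | forall b' : set_type B,
      val b' \in (val b |` S)%fset -> y b' = set_val h b'].
    apply/nbhs_residuesP; exists (val b |` S)%fset => // b' /=.
    by rewrite !inE => /orP[/eqP ->|/SB//]; exact: set_valP.
  have b0 : (0 < val b)%N by apply/Bpos/set_valP.
  have nb : ((val b)%:Z %| n)%Z.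
    by apply/to_residue_eq0 => //; rewrite -hb; apply: nS; rewrite !inE eqxx.
  have n1 : ((lcm_fset S)%:Z %| n - 1)%Z.
    apply/(Delta_coordinatesP _ _ Bpos SB) => b' b'S; rewrite -(Uh b' b'S).
    by apply: nS; rewrite !inE b'S orbT.
  apply: S1; exists (val b); first exact: set_valP.
  have : ((gcdn (val b) (lcm_fset S))%:Z %| n - (n - 1))%Z.
    rewrite rpredB//.
      by apply: dvdz_trans nb; exact: dvdn_gcdl.
    by apply: dvdz_trans n1; exact: dvdn_gcdr.
  by rewrite subKr dvdz1 => /eqP.
rewrite -subset0 => x [_ [[V oV <-] Vx] VW].
have nV : nbhs (set_val x) V by apply: open_nbhs_nbhs.
have /nbhs_residuesP[S SB SV] := nV.
have xH : orbit_group B (set_val x) by exact: set_valP.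
have [|_ [[n _ <-] nS]] := xH [set y | forall b : set_type B,
    val b \in S -> y b = set_val x b].
  by apply/nbhs_residuesP; exists S.
have [b Bb b1] := H S SB.
(* [m] has the coordinates of [n] on [S] and is divisible by [b], so it yields a point of the
   cylinder outside the window. *)
have [m [mn mb]] : exists m : int,
    ((lcm_fset S)%:Z %| m - n)%Z /\ (b%:Z %| m - 0)%Z.
  by apply: chinese_remainder_dvdz; rewrite /coprime gcdnC b1.
have Dm : orbit_group B (Delta B m) by apply: subset_closure; exists m.
pose h : orbit_group B := exist _ (Delta B m) (mem_set Dm).
have /(_ (exist _ b (mem_set Bb)))/eqP : window B h.
  apply: VW; apply: SV => b' b'S; rewrite -(nS b' b'S).
  by move: b' b'S; apply/Delta_coordinatesP.
apply; apply/to_residue_eq0; first exact: Bpos.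
by rewrite subr0 in mb.
Qed.

(** * Zeros of the points of [X_eta] *)

Lemma exists_congruent_offset (L : nat) (n r : int) : (0 < L)%N ->
  exists2 i : nat, (i < L)%N & (L%:Z %| (i%:Z + n) - r)%Z.
Proof.
move=> L0; have Lz : L%:Z != 0 by rewrite eqz_nat -lt0n.
pose i := absz ((r - n) %% L%:Z)%Z.
have iE : i%:Z = ((r - n) %% L%:Z)%Z by rewrite /i gez0_abs ?modz_ge0.
exists i; first by rewrite -ltz_nat iE ltz_pmod.
rewrite (_ : _ - r = i%:Z - (r - n)); last by ring.
by rewrite -eqz_mod_dvd iE modz_mod.
Qed.

(** Otherwise [x] is 1 at some place in every class mod [b]. A shift of eta agrees with [x] at these
    finitely many places, yet one of them is shifted to a multiple of [b], where eta is 0. *)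
Lemma X_eta_residue_zero (B : set nat) (x : config) (b : nat) :
  (0 < b)%N -> B b -> X_eta B x ->
  exists r : int, forall m : int, (b%:Z %| m - r)%Z -> x m = false.
Proof.
move=> b0 Bb Xx; apply: contrapT => none.
have /choice[k kP] : forall r : nat, exists m : int,
    (b%:Z %| m - r%:Z)%Z /\ x m = true.
  move=> r; apply: contrapT => nm; apply: none; exists r%:Z => m bm.
  by apply/negbTE/negP => xm; apply: nm; exists m.
have [|_ [[n _ <-] xn]] := Xx [set y : config |
    forall i : int, i \in [seq k r | r <- iota 0 b] -> y i = x i].
  by apply/nbhs_configP; exists [seq k r | r <- iota 0 b].
have [r rb rn] := exists_congruent_offset n 0 b0.
have [dr kr] := kP r.
have : left_shift n (Defs.eta B) (k r) = true.
  by rewrite xn ?kr// map_f// mem_iota.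
move=> /asboolP; apply; exists b => //=.
rewrite (_ : _ + n = (k r - r%:Z) + (r%:Z + n - 0)); last by ring.
by rewrite rpredD.
Qed.

Lemma left_shift_eta_X_eta (B : set nat) (n : int) :
  X_eta B (left_shift n (Defs.eta B)).
Proof. by apply: subset_closure; exists n. Qed.

Lemma left_shift0 (x : config) : left_shift 0 x = x.
Proof. by apply/funext => i; rewrite /left_shift addr0. Qed.

Lemma left_shiftD (m n : int) (x : config) :
  left_shift m (left_shift n x) = left_shift (m + n) x.
Proof. by apply/funext => i; rewrite /left_shift addrA. Qed.

(** Every pair of a point ([x] or [y]) and a position in [S] gets its own modulus from [D]; the
    Chinese remainder theorem then finds one shift sending every position into the matching zero
    class. *)
Lemma X_eta_common_zeros (B D : set nat) (x y : config) (S : seq int) (N : nat) :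
  B `<=` positive -> D `<=` B -> infinite_set D ->
  (forall a b, D a -> D b -> a <> b -> coprime a b) ->
  X_eta B x -> X_eta B y ->
  exists2 n : nat, (N <= n)%N & forall i, i \in S ->
    left_shift n%:Z x i = false /\ left_shift n%:Z y i = false.
Proof.
move=> Bpos DB Dinf Dco Xx Xy.
have [f finj Df] := infinite_set_injection Dinf.
have f0 i : (0 < f i)%N by apply/Bpos/DB.
have fco i j : i <> j -> coprime (f i) (f j) by move=> ij; apply: Dco => // /finj.
have zeros (z : config) : X_eta B z -> exists r : nat -> int,
    forall i (m : int), ((f i)%:Z %| m - r i)%Z -> z m = false.
  move=> Xz; have /choice[r rP] : forall i, exists r : int,
      forall m : int, ((f i)%:Z %| m - r)%Z -> z m = false.
    by move=> i; apply: (X_eta_residue_zero _ _ Xz) => //; exact: DB.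
  by exists r.
have [rx rxP] := zeros x Xx; have [ry ryP] := zeros y Xy.
(* even indices serve x and odd ones y, so that no modulus is used twice *)
pose r k := (if odd k then ry else rx) k - nth 0 S k./2.
have [n Nn nr] := chinese_remainder_seq r N f0 fco (size S).*2.
exists n => // i iS; pose j := index i S.
have jS : (j < size S)%N by rewrite index_mem.
have nj : nth 0 S j = i by rewrite nth_index.
split; [apply: (rxP j.*2) | apply: (ryP j.*2.+1)].
  have := nr j.*2; rewrite ltn_double jS => /(_ isT).
  by rewrite /r odd_double doubleK nj opprB addrCA addrA.
have := nr j.*2.+1; rewrite ltn_Sdouble jS => /(_ isT).
by rewrite /r /= odd_double /= uphalf_double nj opprB addrCA addrA.
Qed.

(** * The minimal subset *)

Lemma subsystem_shift (Y : set config) (n : nat) (x : config) :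
  subsystem Y -> Y x -> Y (left_shift n%:Z x).
Proof.
move=> [_ _ sY]; elim: n => [|n IH] Yx; first by rewrite left_shift0.
rewrite intS -left_shiftD -sY; exists (left_shift n%:Z x) => //.
exact: IH.
Qed.

Lemma subsystem_zero : subsystem [set zero_config].
Proof.
split; first by exists zero_config.
- move=> x xcl; apply/funext => i.
  have [|_ [-> e]] := xcl [set y : config | y i = x i].
    by apply/nbhs_configP; exists [:: i] => y; apply; rewrite mem_head.
  by rewrite -e.
- by rewrite image_set1.
Qed.

(** Long blocks of zeros put [zero_config] into every subsystem of [X_eta B], so its singleton is
    minimal and the only minimal subset. *)
Lemma the_minimal_subset_zero (B D : set nat) :
  B `<=` positive -> D `<=` B -> infinite_set D ->
  (forall a b, D a -> D b -> a <> b -> coprime a b) ->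
  the_minimal_subset (X_eta B) = [set zero_config].
Proof.
move=> Bpos DB Dinf Dco.
have X0 : X_eta B zero_config.
  move=> A /nbhs_configP[S SA].
  have Xe : X_eta B (Defs.eta B).
    by rewrite -(left_shift0 (Defs.eta B)); exact: left_shift_eta_X_eta.
  have [n _ n0] := X_eta_common_zeros S 0 Bpos DB Dinf Dco Xe Xe.
  exists (left_shift n%:Z (Defs.eta B)); split; first by exists n%:Z.
  by apply: SA => i /n0[].
have zero_in (Z : set config) : subsystem Z -> Z `<=` X_eta B -> Z zero_config.
  move=> sZ ZX; have [[z Zz] Zcl _] := sZ; apply: Zcl => A /nbhs_configP[S SA].
  have [n _ n0] := X_eta_common_zeros S 0 Bpos DB Dinf Dco (ZX _ Zz) (ZX _ Zz).
  exists (left_shift n%:Z z); split; first exact: subsystem_shift.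
  by apply: SA => i /n0[].
have min0 : minimal_subset (X_eta B) [set zero_config].
  split; [by move=> _ ->|exact: subsystem_zero|move=> Z sZ Z0].
  apply/seteqP; split=> // _ ->; apply: zero_in => // z /Z0 ->; exact: X0.
have uniq Z : minimal_subset (X_eta B) Z -> Z = [set zero_config].
  move=> [ZX sZ Zmin]; apply/esym/Zmin; first exact: subsystem_zero.
  by move=> _ ->; exact: zero_in.
(* [xget] satisfies its description only once some set is known to do so. *)
rewrite /the_minimal_subset; set P := (X in xget _ X).
have /(xgetPex set0)[mP _] : exists Y, P Y.
  by exists [set zero_config]; split=> // Z; exact: uniq.
exact: uniq.
Qed.

(** The fallback [set0] is excluded because the singleton is nonempty. *)
Lemma X_eta_zero_of_minimal (B : set nat) :
  the_minimal_subset (X_eta B) = [set zero_config] -> X_eta B zero_config.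
Proof.
rewrite /the_minimal_subset; case: xgetP => [Y -> [[YX _ _] _] Y0|_ /esym e].
  by apply: YX; rewrite Y0.
by have : [set zero_config] zero_config by []; rewrite e.
Qed.

(** If [b] in [B] divided [n], a [c] in [C] dividing [b] would divide both [n] and [n - 1], hence
    1. *)
Lemma eta_periodic_one (B C : set nat) (L : nat) (n : int) :
  [set b%:Z | b in B] `<=` multiples C -> ~ C 1%N ->
  (forall c, C c -> (c %| L)%N) -> (L%:Z %| n - 1)%Z -> Defs.eta B n = true.
Proof.
move=> BC C1 CL Ln; apply/asboolP => -[b Bb bn].
have [|c Cc cb] := BC b%:Z; first by exists b.
have cL : (c%:Z %| L%:Z)%Z by exact: CL.
have : (c%:Z %| n - (n - 1))%Z.
  by apply: rpredB; [exact: dvdz_trans cb bn|exact: dvdz_trans cL Ln].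
by rewrite subKr dvdz1 => /eqP c1; apply: C1; rewrite -(c1 : c = 1%N).
Qed.

(** If 1 is not in [C], every shift of eta has a 1 among the coordinates from 0 to [L - 1], so no
    shift is close to zero. *)
Lemma zero_config_multiples (B C : set nat) : X_eta B zero_config ->
  C `<=` positive -> finite_set C ->
  [set b%:Z | b in B] `<=` multiples C -> C 1%N.
Proof.
move=> X0 Cpos Cfin BC; apply: contrapT => C1.
have [L L0 CL] := finite_set_common_multiple Cpos Cfin.
have [|_ [[n _ <-] n0]] := X0 [set y : config |
    forall i : int, i \in [seq j%:Z | j <- iota 0 L] -> y i = zero_config i].
  by apply/nbhs_configP; exists [seq j%:Z | j <- iota 0 L].
have [i iL di] := exists_congruent_offset n 1 L0.
have /n0 : i%:Z \in [seq j%:Z | j <- iota 0 L] by rewrite map_f// mem_iota.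
by rewrite /left_shift (eta_periodic_one BC C1 CL di).
Qed.

(** * Metrics and proximality *)

Lemma metric_ge0 (R : realType) (T : Type) (rho : T -> T -> R) (x y : T) :
  is_metric rho -> 0 <= rho x y.
Proof.
move=> [rho0 rhoC rho_tri].
have := rho_tri x y x; rewrite (rho0 x x).2// (rhoC y x); lra.
Qed.

(** The lower limit is the supremum of the tail infima; these are nonnegative, so it is 0 exactly
    when all of them are. *)
Lemma limn_einf_eq0P (R : realType) (u : nat -> R) : (forall n, 0 <= u n) ->
  limn_einf (fun n => (u n)%:E) = 0%E <->
  forall (e : R) (N : nat), 0 < e -> exists2 n, (N <= n)%N & u n < e.
Proof.
move=> u0; set v := fun n => (u n)%:E.
have -> : limn_einf v = ereal_sup (range (einfs v)).
  by rewrite limn_einf_lim; apply/cvg_lim => //; exact: cvg_einfs_sup.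
split=> [sup0 e N e0|H].
  apply: contrapT => none.
  have : (e%:E <= einfs v N)%E.
    apply: le_ereal_inf_tmp => _ [n /= Nn <-]; rewrite lee_fin leNgt.
    by apply/negP => une; apply: none; exists n.
  have ub : (einfs v N <= ereal_sup (range (einfs v)))%E.
    by apply: ereal_sup_ubound; exists N.
  by move=> /le_trans/(_ ub); rewrite sup0 lee_fin leNgt e0.
suff e0 N : einfs v N = 0%E.
  rewrite (_ : range _ = [set 0%E]) ?ereal_sup1//.
  by apply/seteqP; split=> [_ [n _ <-]|_ ->] //=; exists 0%N.
apply/eqP; rewrite eq_le; apply/andP; split.
  apply/lee_addgt0Pr => e e0; have [n Nn une] := H e N e0.
  rewrite add0e; apply: le_trans (_ : (v n <= _)%E); last by rewrite lee_fin ltW.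
  by apply: ereal_inf_lbound; exists n.
by apply: le_ereal_inf_tmp => _ [n _ <-]; rewrite lee_fin.
Qed.

Lemma config_compact : compact [set: config].
Proof.
have := @tychonoff int (fun=> bool) (fun=> setT) (fun=> bool_compact).
by congr compact; apply/seteqP; split.
Qed.

(** Otherwise there are ever closer pairs differing at [i]. Near a cluster point [z] of their first
    components, both components take the value [z i] at [i]. *)
Lemma rho_small_agree (R : realType) (rho : config -> config -> R) (i : int) :
  is_metric rho -> induces_topology rho ->
  exists2 e : R, 0 < e & forall x y, rho x y < e -> x i = y i.
Proof.
move=> [_ rhoC rho_tri] rho_top; apply: contrapT => none.
have /choice[u uP] : forall n : nat, exists xy : config * config,
    rho xy.1 xy.2 < n.+1%:R^-1 /\ xy.1 i <> xy.2 i.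
  move=> n; apply: contrapT => nxy; apply: none; exists n.+1%:R^-1 => // x y xy.
  by apply: contrapT => ne; apply: nxy; exists (x, y).
have [|z [_ zcl]] := @config_compact ((fun n => (u n).1) @ \oo) _.
  exact: filterT.
have : nbhs z [set w : config | w i = z i].
  by apply/nbhs_configP; exists [:: i] => w; apply; rewrite mem_head.
rewrite rho_top => -[e /= e0 ze].
have e20 : 0 < e / 2 by rewrite divr_gt0.
have nz : nbhs z [set w | rho z w < e / 2] by rewrite rho_top; exists (e / 2).
(* From index [K] on the pairs are within [e / 2], so a first component within [e / 2] of [z] puts
   the second within [e]. *)
have [K _ KP] := near_infty_natSinv_lt (PosNum e20).
have FK : ((fun n => (u n).1) @ \oo) [set w | exists2 n, (K <= n)%N & w = (u n).1].
  by exists K => // n /= Kn; exists n.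
have [_ [[n Kn ->] zun]] := zcl _ _ FK nz.
have [un ne] := uP n; apply: ne.
have une : rho (u n).1 (u n).2 < e / 2 by apply: lt_trans un _; exact: KP.
rewrite (ze (u n).1); last by rewrite /=; move: zun => /=; lra.
rewrite (ze (u n).2)//=; apply: le_lt_trans (rho_tri _ (u n).1 _) _.
by move: zun => /=; lra.
Qed.

Lemma rho_small_agree_seq (R : realType) (rho : config -> config -> R)
    (S : seq int) : is_metric rho -> induces_topology rho ->
  exists2 e : R, 0 < e & forall x y, rho x y < e -> {in S, x =1 y}.
Proof.
move=> rho_metric rho_top; elim: S => [|i S [e e0 eP]]; first by exists 1.
have [d d0 dP] := rho_small_agree i rho_metric rho_top.
exists (Num.min d e) => [|x y]; first by rewrite lt_min d0.
rewrite lt_min => /andP[xyd xye] j; rewrite inE => /orP[/eqP ->|]; first exact: dP.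
exact: eP.
Qed.

(** At a common block of zeros both shifted points are within [e / 2] of [zero_config]. *)
Lemma proximal_of_coprime (R : realType) (rho : config -> config -> R)
    (B D : set nat) : is_metric rho -> induces_topology rho ->
  B `<=` positive -> D `<=` B -> infinite_set D ->
  (forall a b, D a -> D b -> a <> b -> coprime a b) -> proximal_on rho (X_eta B).
Proof.
move=> rho_metric rho_top Bpos DB Dinf Dco x y Xx Xy.
have [_ rhoC rho_tri] := rho_metric.
apply/limn_einf_eq0P => [n|e N e0]; first exact: metric_ge0.
have : nbhs zero_config [set w | rho zero_config w < e / 2].
  by rewrite rho_top; exists (e / 2) => //=; rewrite divr_gt0.
move=> /nbhs_configP[S SP].
have [n Nn n0] := X_eta_common_zeros S N Bpos DB Dinf Dco Xx Xy.
exists n => //; apply: le_lt_trans (rho_tri _ zero_config _) _.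
have /= := SP (left_shift n%:Z x) (fun i iS => (n0 i iS).1).
have /= := SP (left_shift n%:Z y) (fun i iS => (n0 i iS).2).
rewrite (rhoC _ zero_config); lra.
Qed.

Lemma eq_succ_const (f : nat -> bool) (N : nat) :
  (forall i, (i < N)%N -> f i = f i.+1) ->
  forall i, (i <= N)%N -> f i = f 0%N.
Proof.
by move=> fS; elim=> // i IH iN; rewrite -fS// IH// ltnW.
Qed.

(** The pair tested is eta and its shift by 1: agreement on a block makes eta constant there, but
    the block meets both [1 + L Z], where eta is 1, and [b Z], where it is 0. *)
Lemma proximal_multiples (R : realType) (rho : config -> config -> R)
    (B C : set nat) : is_metric rho -> induces_topology rho ->
  B `<=` positive -> B !=set0 -> proximal_on rho (X_eta B) ->
  C `<=` positive -> finite_set C ->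
  [set b%:Z | b in B] `<=` multiples C -> C 1%N.
Proof.
move=> rho_metric rho_top Bpos [b Bb] prox Cpos Cfin BC; apply: contrapT => C1.
have [L L0 CL] := finite_set_common_multiple Cpos Cfin.
have b0 := Bpos b Bb.
(* Length [L + b] leaves room for an offset below [L] and one below [b]. *)
pose S : seq int := [seq j%:Z | j <- iota 0 (L + b)].
have [e e0 eP] := rho_small_agree_seq S rho_metric rho_top.
have /limn_einf_eq0P/(_ e 0%N e0) :=
  prox _ _ (@left_shift_eta_X_eta B 0) (@left_shift_eta_X_eta B 1).
case=> [n|n _ /eP agree]; first exact: metric_ge0.
pose f (i : nat) := Defs.eta B (i%:Z + n%:Z).
have fc := @eq_succ_const f (L + b).
have {}fc i : (i < L + b)%N -> f i = f 0%N.
  move=> iLb; apply: fc (ltnW iLb) => j jLb.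
  have /agree : j%:Z \in S by rewrite map_f// mem_iota.
  by rewrite /left_shift addr0 /f intS => ->; congr Defs.eta; ring.
have [i iL di] := exists_congruent_offset n%:Z 1 L0.
have [j jb dj] := exists_congruent_offset n%:Z 0 b0.
have fi : f i = true by exact: eta_periodic_one BC C1 CL di.
have : f j = true by rewrite fc ?ltn_addl// -(fc i) ?ltn_addr.
by move=> /asboolP; apply; exists b => //=; rewrite subr0 in dj.
Qed.

(** * The cycle of implications *)

Theorem theoremC (R : realType) (rho : config -> config -> R)
    (rho_metric : is_metric rho) (rho_top : induces_topology rho)
    (B : set nat) (B_pos : B `<=` positive) (B_inf : infinite_set B)
    (B_prim : primitive B) :
  [<-> (* C1 *) (@window B)^° = set0;
       (* C2 *) \bigcup_(S in [set S : {fset nat} | [set` S] `<=` B])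
                  free_numbers (gcd_set B S) = set0;
       (* C3 *) forall S : {fset nat}, [set` S] `<=` B -> gcd_set B S 1%N;
       (* C4 *) exists D : set nat, [/\ D `<=` B, infinite_set D &
                  forall a b, D a -> D b -> a <> b -> coprime a b];
       (* C5 *) forall C : set nat, C `<=` positive -> finite_set C ->
                  [set b%:Z | b in B] `<=` multiples C -> C 1%N;
       (* C6 *) the_minimal_subset (X_eta B) = [set zero_config];
       (* C7 *) proximal_on rho (X_eta B)].
Proof.
have C34 := coprime_seq_of_gcd_set B_inf B_prim.
(* Together with [C34] this recovers the coprime set [D] from C5, as needed to reach C6 and C7; it
   also closes the cycle from C7 to C1. *)
have C53 : (forall C : set nat, C `<=` positive -> finite_set C ->
    [set b%:Z | b in B] `<=` multiples C -> C 1%N) ->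
    forall S : {fset nat}, [set` S] `<=` B -> gcd_set B S 1%N.
  by move=> C5 S SB; exact: gcd_set_of_multiples.
tfae.
- by move=> /(window_interior_empty B_pos)/gcd_set_free_numbers_empty.
- by move=> /gcd_set_free_numbers_empty.
- exact: C34.
- move=> [D [DB Dinf Dco]] C _ Cfin BC.
  apply: (coprime_subset_multiples Dinf Dco Cfin) => _ [d /DB Bd <-].
  by apply: BC; exists d.
- by move=> /C53/C34[D [DB Dinf Dco]]; exact: the_minimal_subset_zero DB Dinf Dco.
- move=> /X_eta_zero_of_minimal X0.
  have /C53/C34[D [DB Dinf Dco]] := fun C => @zero_config_multiples B C X0.
  exact: proximal_of_coprime DB Dinf Dco.
- move=> prox; apply/(window_interior_empty B_pos)/C53 => C.
  by apply: proximal_multiples prox => //; exact: infinite_setN0.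
Qed.
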